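(* Let $G$ be a finite simple non-complete connected graph on the vertex set $[n]=\{1,\ldots,n\}$, and put $\phi(G)=f(G)+\operatorname{diam}(G)+\kappa(G)$. Then the following hold: (1) If $n<9$, then there is no such graph $G$ with $\phi(G)=3$. (2) If $n\geq 9$, then $\phi(G)=3$ if and only if $G=K_1*H$ (up to isomorphism), where $H$ is a disconnected graph with no free vertex.
   Context: For a finite simple connected graph $G$ on $[n]$: the distance of two distinct vertices is the smallest length (number of edges) of a path in $G$ connecting them, and $\operatorname{diam}(G)$ is the maximum of all such distances. $\kappa(G)$ denotes the vertex connectivity: for non-complete $G$, the smallest cardinality of a subset $T\subset[n]$ such that the induced subgraph of $G$ on $[n]\setminus T$ is disconnected. A vertex $i$ of a finite simple graph (connected or not) is free (simplicial) if whenever $\{i,j\}$ and $\{i,j'\}$ are edges with $j\neq j'$, then $\{j,j'\}$ is an edge; in particular an isolated vertex is free. $f(G)$ denotes the number of free vertices of $G$. All graphs are finite and simple. $K_1$ is the graph with a single vertex. For graphs $G_1,G_2$ on disjoint vertex sets, the join product $G_1*G_2$ is the graph on $V(G_1)\cup V(G_2)$ with edge set $E(G_1)\cup E(G_2)\cup\{\{i,j\}: i\in V(G_1),\, j\in V(G_2)\}$. *)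

(* Defs.v *)
From mathcomp Require Import all_boot.

Set Implicit Arguments.
Unset Strict Implicit.
Unset Printing Implicit Defensive.

Record sgraph (V : finType) := SGraph {
  adj :> rel V;
  adj_sym : symmetric adj;
  adj_irrefl : irreflexive adj }.

Definition graph_iso (V W : finType) (G : sgraph V) (H : sgraph W) : Prop :=
  exists2 f : V -> W, bijective f & forall x y, H (f x) (f y) = G x y.

Section Invariants.
Variables (V : finType) (G : sgraph V).

Definition complete : bool := [forall x, forall y, (x != y) ==> G x y].

(* The graph without vertices counts as connected. *)
Definition connected : bool := [forall x, forall y, connect G x y].

Definition has_path (x y : V) (k : nat) : bool :=
  [exists p : k.-tuple V, [&& path G x p, last x p == y & uniq (x :: p)]].

(* A path has fewer than #|V| edges; the value #|V| is only taken when no path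
   connects x and y. *)
Definition dist (x y : V) : nat :=
  \big[minn/#|V|]_(k < #|V| | has_path x y k) k.

Definition diam : nat := \max_(x : V) \max_(y : V | x != y) dist x y.

Definition free_vertex (i : V) : bool :=
  [forall j, forall j', [&& G i j, G i j' & j != j'] ==> G j j'].

Definition num_free : nat := #|[set i | free_vertex i]|.

End Invariants.

Section Induced.
Variables (V : finType) (G : sgraph V) (A : {set V}).

Definition induced_adj : rel {x : V | x \in A} := relpre val G.

Fact induced_adj_sym : symmetric induced_adj.
Proof. by move=> x y; apply: adj_sym. Qed.

Fact induced_adj_irrefl : irreflexive induced_adj.
Proof. by move=> x; apply: adj_irrefl. Qed.

Definition induced : sgraph {x : V | x \in A} :=
  SGraph induced_adj_sym induced_adj_irrefl.
End Induced.

(* A set whose removal disconnects G has at most #|V| - 2 elements, so the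
   default #|V| - 1 is only taken when no such set exists, i.e. when G is
   complete. *)
Definition vconn (V : finType) (G : sgraph V) : nat :=
  \big[minn/#|V|.-1]_(T : {set V} | ~~ connected (induced G (~: T))) #|T|.

Definition phi (V : finType) (G : sgraph V) : nat :=
  num_free G + diam G + vconn G.

Section Join.
Variables (V1 V2 : finType) (G1 : sgraph V1) (G2 : sgraph V2).

Definition join_adj : rel (V1 + V2) := fun u v =>
  match u, v with
  | inl x, inl y => G1 x y
  | inr x, inr y => G2 x y
  | _, _ => true
  end.

Fact join_adj_sym : symmetric join_adj.
Proof. by case=> x [] y //=; apply: adj_sym. Qed.

Fact join_adj_irrefl : irreflexive join_adj.
Proof. by case=> x /=; apply: adj_irrefl. Qed.

Definition join_graph : sgraph (V1 + V2)%type :=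
  SGraph join_adj_sym join_adj_irrefl.
End Join.

Fact K1_sym : symmetric (fun _ _ : unit => false).
Proof. by []. Qed.

Fact K1_irrefl : irreflexive (fun _ _ : unit => false).
Proof. by []. Qed.

Definition K1 : sgraph unit := SGraph K1_sym K1_irrefl.

(* Main.v *)
(** Since [G] is connected and non-complete, [diam G >= 2] and [vconn G >= 1],
    so [phi G = 3] forces no free vertex, diameter 2 and a cut vertex [v].
    Two vertices separated by [v] can only be at distance 2 through [v], so [v]
    is adjacent to all other vertices and [G = K1 * (G - v)]; as [v] is
    dominating, a vertex of [G - v] is free in [G - v] iff it is free in [G].
    A component without free vertex has at least four vertices, so [G - v] has
    at least eight. *)
Require Import Defs.
From mathcomp Require Import all_boot.

Set Implicit Arguments.
Unset Strict Implicit.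
Unset Printing Implicit Defensive.

(** * Minima with a default value, and set witnesses of disconnectedness *)

(** The default [d] acts as one more candidate for the minimum. Both [dist] and [vconn] have this
    form, so bounding them by a number below [d] amounts to exhibiting a path or a cut. *)
Lemma bigminn_leP (I : finType) (P : pred I) (F : I -> nat) (d m : nat) :
  reflect (d <= m \/ exists2 i, P i & F i <= m)
          (\big[minn/d]_(i | P i) F i <= m).
Proof.
apply: (iffP idP) => [|le_m].
  elim/big_rec: _ => [|i x Pi IHx]; first by left.
  by rewrite geq_min => /orP[le_m|/IHx //]; right; exists i.
case: le_m => [le_dm | [i Pi le_m]].
  by elim/big_rec: _ => // i x _ le_xm; rewrite geq_min le_xm orbT.
rewrite -big_filter.
have: i \in [seq i <- index_enum I | P i] by rewrite mem_filter Pi mem_index_enum.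
elim: [seq _ <- _ | _] => // j s IHs; rewrite inE big_cons geq_min.
by case/predU1P => [<-|/IHs ->]; rewrite ?le_m ?orbT.
Qed.

(** The component of a vertex that fails to reach some other vertex serves as [A]; conversely no
    walk leaves a set closed under adjacency. *)
Lemma connectedPn (V : finType) (G : sgraph V) :
  reflect (exists A : {set V}, [/\ A != set0, ~: A != set0 &
             forall x y, G x y -> (x \in A) = (y \in A)])
          (~~ connected G).
Proof.
apply: (iffP idP) => [|[A [/set0Pn[x Ax] /set0Pn[y]]]].
  rewrite negb_forall => /existsP[x]; rewrite negb_forall => /existsP[y nxy].
  exists [set z | connect G x z]; split.
  - by apply/set0Pn; exists x; rewrite inE connect0.
  - by apply/set0Pn; exists y; rewrite !inE.
  - move=> z t Gzt; rewrite !inE; apply: same_connect1r => //.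
    exact/sym_connect_sym/adj_sym.
rewrite inE => nAy clA; apply/negP => /forallP/(_ x)/forallP/(_ y) xy.
by move: nAy; rewrite -(closed_connect clA xy) Ax.
Qed.

(** Here [A] is a set in [V] rather than in the subtype, and only its trace on [D] matters; later
    arguments thus stay among the vertices of [G]. *)
Lemma induced_connectedPn (V : finType) (G : sgraph V) (D : {set V}) :
  reflect (exists A : {set V}, [/\ A :&: D != set0, D :\: A != set0 &
             {in D &, forall x y, G x y -> (x \in A) = (y \in A)}])
          (~~ connected (induced G D)).
Proof.
apply: (iffP (connectedPn _)) => -[A [/set0Pn[x Ax] /set0Pn[y Ay] clA]].
  exists (val @: A); split.
  - by apply/set0Pn; exists (val x); rewrite inE imset_f //= (valP x).
  - apply/set0Pn; exists (val y).
    by rewrite inE (mem_imset _ _ val_inj) (valP y) andbT; rewrite inE in Ay.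
  - move=> z t Dz Dt Gzt.
    have -> : z = val (exist (fun x => x \in D) z Dz) by [].
    have -> : t = val (exist (fun x => x \in D) t Dt) by [].
    by rewrite !(mem_imset _ _ val_inj); apply: clA.
move: Ax Ay; rewrite !inE => /andP[Ax Dx] /andP[nAy Dy].
exists [set z | val z \in A]; split.
- by apply/set0Pn; exists (exist _ x Dx); rewrite inE.
- by apply/set0Pn; exists (exist _ y Dy); rewrite !inE.
- by move=> z t Gzt; rewrite !inE; apply: clA; rewrite ?(valP z) ?(valP t).
Qed.

(** * Distance and diameter *)

Section Distance.
Variables (V : finType) (G : sgraph V).
Implicit Types x y : V.

(** The bound [m < #|V|] rules out the default [#|V|] of [dist], so a genuine path must realise the
    inequality. *)
Lemma dist_leP x y m : m < #|V| ->
  reflect (exists p, [/\ size p <= m, path G x p, last x p = y & uniq (x :: p)])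
          (dist G x y <= m).
Proof.
move=> ltmV; apply: (iffP (bigminn_leP _ _ _ _)) => [[|[k]]|].
- by rewrite leqNgt ltmV.
- case/existsP=> p /and3P[Gp /eqP lastp Up] le_km.
  by exists p; rewrite size_tuple.
- case=> p [le_pm Gp lastp Up]; right.
  exists (Ordinal (leq_ltn_trans le_pm ltmV)) => //=.
  by apply/existsP; exists (in_tuple p); rewrite /= Gp lastp eqxx.
Qed.

Lemma dist_le1 x y : 1 < #|V| -> x != y -> (dist G x y <= 1) = G x y.
Proof.
move=> V2 neq_xy; apply/(dist_leP _ _ V2)/idP => [[[|z [|? ?]] [] //=]|Gxy].
- by move=> _ _ eq_xy; rewrite eq_xy eqxx in neq_xy.
- by rewrite andbT => _ Gxz <-.
- by exists [:: y]; rewrite /= Gxy inE neq_xy.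
Qed.

Lemma dist_le2 x y : 2 < #|V| -> x != y ->
  reflect (G x y \/ exists2 z, G x z & G z y) (dist G x y <= 2).
Proof.
move=> V3 neq_xy; apply: (iffP (dist_leP _ _ V3)).
  case=> -[|z [|t [|? ?]]] [] //=.
  - by move=> _ _ eq_xy; rewrite eq_xy eqxx in neq_xy.
  - by rewrite andbT => _ Gxz <-; left.
  - by rewrite andbT => _ /andP[Gxz Gzt] <-; right; exists z.
case=> [Gxy | [z Gxz Gzy]].
  by exists [:: y]; rewrite /= Gxy inE neq_xy.
exists [:: z; y]; rewrite /= Gxz Gzy !inE negb_or neq_xy !andbT.
split=> //; apply/andP; split.
  by apply: contraTneq Gxz => ->; rewrite adj_irrefl.
by apply: contraTneq Gzy => ->; rewrite adj_irrefl.
Qed.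

Lemma diam_leP m :
  reflect (forall x y, x != y -> dist G x y <= m) (diam G <= m).
Proof.
apply: (iffP (bigmax_leqP _ _ _)) => [le_m x y neq_xy | le_m x _].
  by have /bigmax_leqP/(_ y neq_xy) := le_m x isT.
by apply/bigmax_leqP => y; apply: le_m.
Qed.

End Distance.

(** * Lower bounds on the invariants, and the case of equality *)

Section ConnectedNoncomplete.
Variables (V : finType) (G : sgraph V).
Hypotheses (G_connected : connected G) (G_noncomplete : ~~ complete G).

Let nonadjacent : exists x y, x != y /\ ~~ G x y.
Proof.
move: G_noncomplete; rewrite negb_forall => /existsP[x].
rewrite negb_forall => /existsP[y]; rewrite negb_imply => /andP[? ?].
by exists x, y.
Qed.

(** Besides two nonadjacent vertices [x] and [y], there is the first vertex [z] after [x] on a walk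
    from [x] to [y]. *)
Lemma noncomplete_card : 2 < #|V|.
Proof.
have [x [y [neq_xy nGxy]]] := nonadjacent.
have /connectP[p] := forallP (forallP G_connected x) y.
case: p => [|z p] /=; first by move=> _ eq_yx; rewrite eq_yx eqxx in neq_xy.
case/andP=> Gxz _ _.
suff /card_uniqP/= <- : uniq [:: x; y; z] by apply: max_card.
rewrite /= !inE negb_or neq_xy /= andbT; apply/andP; split.
  by apply: contraTneq Gxz => <-; rewrite adj_irrefl.
by apply: contraNneq nGxy => ->.
Qed.

Lemma noncomplete_diam_gt1 : 1 < diam G.
Proof.
have [x [y [neq_xy nGxy]]] := nonadjacent.
rewrite ltnNge; apply: contra nGxy => /diam_leP/(_ x y neq_xy).
by rewrite dist_le1 // ltnW // noncomplete_card.
Qed.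

Lemma connected_vconn_gt0 : 0 < vconn G.
Proof.
rewrite ltnNge; apply/negP => /bigminn_leP[|[T]].
  by have := noncomplete_card; case: #|V| => [|[]].
move=> disc; rewrite leqn0 cards_eq0 => /eqP T0.
move: disc; rewrite {T}T0 setC0.
case/induced_connectedPn=> A [Ax Ay clA].
suff: ~~ connected G by rewrite G_connected.
apply/connectedPn.
exists A; move: Ax Ay; rewrite setIT setTD; split=> // x y.
exact: clA.
Qed.

Lemma phi_eq3P :
  phi G = 3 <->
  exists v, [/\ forall x, x != v -> G v x,
                ~~ connected (induced G (~: [set v])) &
                forall x, ~~ free_vertex G x].
Proof.
have V3 := noncomplete_card.
have d1 := noncomplete_diam_gt1; have k0 := connected_vconn_gt0.
split=> [phi3 | [v [domv disc nofree]]].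
  (* The lower bounds 2 and 1 on diameter and connectivity already add up to 3, so nothing is left
     for any of the three terms to exceed its minimum. *)
  have [f0 d2 k1] : [/\ num_free G = 0, diam G <= 2 & vconn G <= 1].
    move: phi3 d1 k0; rewrite /phi.
    case: (num_free G) (diam G) (vconn G) => [|f] [|[|[|d]]] [|[|k]] //=;
      by rewrite !(addnS, addSn).
  (* The default [#|V|.-1] is at least 2, so the bound 1 comes from an actual cut [T]. *)
  have {k1} [|[T disc T1]] := bigminn_leP _ _ _ _ k1.
    by case: #|V| V3 => [|[|[]]].
  have /induced_connectedPn[A [/set0Pn[a ATa] /set0Pn[b ATb] clA]] := disc.
  move: ATa ATb; rewrite !inE => /andP[Aa Ta] /andP[nAb Tb].
  (* Vertices on opposite sides of the cut are not adjacent, so diameter 2 gives them a common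
     neighbour. Lying on either side, it would be adjacent to a vertex across the cut; hence it lies
     in [T]. *)
  have common x y : x \in A -> x \notin T -> y \notin A -> y \notin T ->
      exists2 z, z \in T & G x z && G z y.
    move=> Ax Tx Ay Ty.
    have nGxy z t : z \in A -> z \notin T -> t \notin A -> t \notin T -> ~~ G z t.
      move=> Az Tz At Tt; apply/negP => /clA; rewrite !inE Az (negPf At).
      by move/(_ Tz Tt).
    have neq_xy : x != y by apply: contraNneq Ay => <-.
    have /(dist_le2 G V3 neq_xy)[Gxy|[z Gxz Gzy]] :=
      diam_leP G _ d2 x y neq_xy.
      by have := nGxy x y Ax Tx Ay Ty; rewrite Gxy.
    exists z; last by rewrite Gxz.
    apply/negPn/negP => Tz; have [Az | nAz] := boolP (z \in A).
      by have := nGxy z y Az Tz Ay Ty; rewrite Gzy.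
    by have := nGxy x z Ax Tx nAz Tz; rewrite Gxz.
  have [v Tv _] := common a b Aa Ta nAb Tb.
  have {}Tv : T = [set v].
    by apply/eqP; rewrite eq_sym eqEcard sub1set Tv cards1.
  exists v; split; rewrite -?Tv //.
    (* Pair [x] with [a] or [b], whichever lies on the other side: their common neighbour can only
       be [v]. *)
    move=> x neq_xv; have Tx : x \notin T by rewrite Tv inE.
    have [Ax | nAx] := boolP (x \in A).
      have [z] := common x b Ax Tx nAb Tb; rewrite Tv inE => /eqP->.
      by case/andP; rewrite adj_sym.
    have [z] := common a x Aa Ta nAx Tx; rewrite Tv inE => /eqP->.
    by case/andP.
  move=> x; apply/negP => freex; move/eqP: f0; rewrite cards_eq0.
  by move/eqP/setP/(_ x); rewrite !inE freex.
have f0 : num_free G = 0.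
  apply/eqP; rewrite cards_eq0; apply/eqP/setP => x.
  by rewrite !inE (negPf (nofree x)).
have d2 : diam G <= 2.
  apply/diam_leP => x y neq_xy; apply/(dist_le2 G V3 neq_xy).
  have [eq_xv | neq_xv] := eqVneq x v.
    by left; rewrite eq_xv domv // -eq_xv eq_sym.
  have [eq_yv | neq_yv] := eqVneq y v.
    by left; rewrite eq_yv adj_sym domv.
  by right; exists v; rewrite ?domv // adj_sym domv.
have k1 : vconn G <= 1.
  by apply/bigminn_leP; right; exists [set v]; rewrite ?cards1.
have /eqP d_eq : diam G == 2 by rewrite eqn_leq d2.
have /eqP k_eq : vconn G == 1 by rewrite eqn_leq k1.
by rewrite /phi f0 d_eq k_eq.
Qed.

End ConnectedNoncomplete.

(** * Free vertices and isomorphisms for joins with [K1] *)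

Lemma free_vertex_iso (V W : finType) (G : sgraph V) (H : sgraph W)
    (f : V -> W) (x : V) :
  bijective f -> (forall x y, H (f x) (f y) = G x y) ->
  free_vertex H (f x) = free_vertex G x.
Proof.
move=> [g fK gK] fG; apply/forallP/forallP => freex y; apply/forallP => z.
  have /forallP/(_ (f z)) := freex (f y).
  by rewrite !fG (can_eq fK).
by have /forallP/(_ (g z)) := freex (g y); rewrite -!fG !gK (can_eq gK).
Qed.

(** The apex is adjacent to every vertex of [H], so a pair of neighbours of [w] involving it never
    violates freeness. *)
Lemma free_vertex_joinK1 (W : finType) (H : sgraph W) (w : W) :
  free_vertex (join_graph K1 H) (inr w) = free_vertex H w.
Proof.
apply/forallP/forallP => freew y; apply/forallP => z.
  exact: (forallP (freew (inr y)) (inr z)).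
by case: y z => [[]|y] [[]|z] //=; rewrite ?implybT //; apply: (forallP (freew y)).
Qed.

(** Two vertices of [H] in different components are nonadjacent neighbours of the apex. *)
Lemma free_vertex_apexN (W : finType) (H : sgraph W) :
  ~~ connected H -> ~~ free_vertex (join_graph K1 H) (inl tt).
Proof.
case/connectedPn=> A [/set0Pn[x Ax] /set0Pn[y]]; rewrite inE => nAy clA.
apply/negP => /forallP/(_ (inr x))/forallP/(_ (inr y))/implyP /=.
have neq_xy : x != y by apply: contraNneq nAy => <-.
by move/(_ neq_xy)/clA; rewrite Ax (negPf nAy).
Qed.

Section DominatingVertex.
Variables (V : finType) (G : sgraph V) (v : V).
Hypothesis domv : forall x, x != v -> G v x.

Let W : finType := {x : V | x \in ~: [set v]}.

Lemma dominating_iso : graph_iso G (join_graph K1 (induced G (~: [set v]))).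
Proof.
(* [insub] fails exactly at [v], which is therefore sent to the apex. *)
pose f x : unit + W := if insub x is Some w then inr w else inl tt.
pose g (u : unit + W) : V := if u is inr w then val w else v.
have fK : cancel f g.
  move=> x; rewrite /f; case: insubP => [w _ <- //|].
  by rewrite !inE negbK => /eqP->.
have gK : cancel g f.
  case=> [[]|w]; rewrite /f /= ?valK // insubF //.
  by rewrite !inE eqxx.
exists f => [|x y]; first by exists g.
(* Only the arguments of [G] are rewritten through [g], so that cases on [f x] and [f y] decide both
   sides at once. *)
rewrite -{2}[x]fK -{2}[y]fK; case: (f x) (f y) => [[]|w] [[]|w'] //=.
- by rewrite adj_irrefl.
- by rewrite domv //; have := valP w'; rewrite !inE.
- by rewrite adj_sym domv //; have := valP w; rewrite !inE.
Qed.

End DominatingVertex.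

(** The preimage of the apex is the required [v], and a separation of [H] is carried back to [G]
    along the inverse isomorphism. *)
Lemma joinK1_iso_dominating (V W : finType) (G : sgraph V) (H : sgraph W) :
  ~~ connected H -> (forall w, ~~ free_vertex H w) ->
  graph_iso G (join_graph K1 H) ->
  exists v, [/\ forall x, x != v -> G v x,
                ~~ connected (induced G (~: [set v])) &
                forall x, ~~ free_vertex G x].
Proof.
move=> disc nofree [f bijf fG]; have [g fK gK] := bijf.
exists (g (inl tt)); split=> [x neq_xv||x].
- rewrite -fG gK; case Dfx: (f x) => [[]|w] //.
  by rewrite -Dfx fK eqxx in neq_xv.
- have /connectedPn[A [/set0Pn[a Aa] /set0Pn[b]]] := disc.
  rewrite inE => nAb clA; apply/induced_connectedPn.
  exists [set g (inr w) | w in A].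
  have memA w : (g (inr w) \in [set g (inr w) | w in A]) = (w \in A).
    by rewrite (@mem_imset _ _ (fun w => g (inr w))) // => s t /(can_inj gK)[].
  split.
  + by apply/set0Pn; exists (g (inr a)); rewrite 3!inE memA Aa (can_eq gK).
  + by apply/set0Pn; exists (g (inr b)); rewrite 3!inE memA nAb (can_eq gK).
  + move=> x y; rewrite !inE -fG -{1 3}[x]fK -{1 3}[y]fK.
    case: (f x) (f y) => [[]|s] [[]|t]; rewrite ?eqxx // => _ _ /clA.
    by rewrite !memA.
- rewrite -(free_vertex_iso _ bijf fG); case: (f x) => [[]|w].
    exact: free_vertex_apexN.
  by rewrite free_vertex_joinK1.
Qed.

(** * Counting vertices in graphs without free vertices *)

Lemma free_vertexPn (V : finType) (G : sgraph V) (x : V) :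
  reflect (exists y z, [/\ G x y, G x z, y != z & ~~ G y z])
          (~~ free_vertex G x).
Proof.
rewrite negb_forall; apply: (iffP existsP) => [[y]|[y [z [Gxy Gxz neq nG]]]].
  rewrite negb_forall => /existsP[z]; rewrite negb_imply.
  by case/andP=> /and3P[? ? ?] ?; exists y, z.
by exists y; rewrite negb_forall; apply/existsP; exists z; rewrite Gxy Gxz neq.
Qed.

(** A vertex [x] of [A] has two nonadjacent neighbours [y] and [z], and [y], not being free, has a
    neighbour [t] other than [x]. Since [y] and [z] are not adjacent, [t] differs from [z], and
    closedness keeps all four in [A]. *)
Lemma nofree_closed_card (V : finType) (G : sgraph V) (A : {set V}) :
  (forall x, ~~ free_vertex G x) -> A != set0 ->
  (forall x y, G x y -> (x \in A) = (y \in A)) -> 4 <= #|A|.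
Proof.
move=> nofree /set0Pn[x Ax] clA.
have adjN a b : G a b -> a != b.
  by move=> Gab; apply: contraTneq Gab => ->; rewrite adj_irrefl.
have [y [z [Gxy Gxz neq_yz nGyz]]] := free_vertexPn _ _ (nofree x).
have [t Gyt neq_tx] : exists2 t, G y t & t != x.
  have [s [t [Gys Gyt neq_st _]]] := free_vertexPn _ _ (nofree y).
  by have [eq_sx | neq_sx] := eqVneq s x; [exists t | exists s];
    rewrite // -eq_sx eq_sym.
have Ay : y \in A by rewrite -(clA _ _ Gxy).
have U : uniq [:: x; y; z; t].
  rewrite /= !inE !negb_or neq_yz (adjN _ _ Gxy) (adjN _ _ Gxz) (adjN _ _ Gyt).
  rewrite [x == t]eq_sym neq_tx /= andbT.
  by apply: contraNneq nGyz => ->.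
apply/card_geqP; exists [:: x; y; z; t]; split=> // u.
by rewrite !inE => /or4P[]/eqP-> //; rewrite -?(clA _ _ Gxz) -?(clA _ _ Gyt).
Qed.

(** Both sides of a separation are closed under adjacency, so each contributes at least 4
    vertices. *)
Lemma disconnected_nofree_card (V : finType) (G : sgraph V) :
  ~~ connected G -> (forall x, ~~ free_vertex G x) -> 8 <= #|V|.
Proof.
case/connectedPn=> A [A0 cA0 clA] nofree.
rewrite -(cardsC A) (@leq_add 4 4) // (nofree_closed_card nofree) // => x y Gxy.
by rewrite !inE (clA x y Gxy).
Qed.

Theorem theorem1p2 (n : nat) (G : sgraph 'I_n)
    (G_connected : connected G) (G_noncomplete : ~~ complete G) :
  (n < 9 -> phi G <> 3) /\
  (9 <= n ->
     (phi G = 3 <->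
      exists (W : finType) (H : sgraph W),
        [/\ ~~ connected H,
            (forall w : W, ~~ free_vertex H w) &
            graph_iso G (join_graph K1 H)])).
Proof.
have phi3E : phi G = 3 <->
    exists (W : finType) (H : sgraph W),
      [/\ ~~ connected H, (forall w : W, ~~ free_vertex H w) &
          graph_iso G (join_graph K1 H)].
  split=> [|[W [H [disc nofree isoGH]]]]; last first.
    exact/(phi_eq3P G_connected G_noncomplete)/(joinK1_iso_dominating disc).
  case/(phi_eq3P G_connected G_noncomplete)=> v [domv disc nofree].
  exists {x | x \in ~: [set v]}, (induced G (~: [set v])).
  have isoG := dominating_iso domv; split=> // w.
  have [f bijf fG] := isoG; have [g _ gK] := bijf.
  (* Freeness of [w] is read in the join and then, through the isomorphism, in [G], where no vertex
     is free. *)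
  by rewrite -free_vertex_joinK1 -(gK (inr w)) (free_vertex_iso _ bijf fG).
split=> [lt_n9 /phi3E[W [H [disc nofree [f bijf _]]]] | _]; last exact: phi3E.
(* The isomorphism gives [n = 1 + #|W|], and [#|W|] is at least 8, against [n < 9]. *)
have := disconnected_nofree_card disc nofree; have := bij_eq_card bijf.
rewrite card_ord card_sum card_unit => eq_n.
by move: lt_n9; rewrite eq_n ltnNge => /negP.
Qed.
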